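(* $17\le M(48)\le 31$.
   Context: For a positive integer $n$, $\tau(n)$ denotes the number of positive divisors of $n$. For a positive integer $k$, $M(k)$ denotes the maximal length of a run of consecutive positive integers each having exactly $k$ divisors, i.e. the largest $L$ for which there is a positive integer $n$ with $\tau(n)=\tau(n+1)=\dots=\tau(n+L-1)=k$. *)

(* Defs.v *)
From mathcomp Require Import all_boot.
From mathcomp Require Import boolp.

Set Implicit Arguments.
Unset Strict Implicit.
Unset Printing Implicit Defensive.

Definition tau (n : nat) : nat := size (divisors n).

Definition equidiv_run (k L n : nat) : Prop :=
  0 < n /\ forall i : nat, i < L -> tau (n + i) = k.

Definition run_length (k : nat) : pred nat :=
  fun L => `[< exists n : nat, equidiv_run k L n >].

Lemma run_length_ex (k : nat) : exists L, run_length k L.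
Proof. by exists 0; apply/asboolP; exists 1. Qed.

Lemma tau_dvd_exp2 (k n : nat) : 0 < n -> 2 ^ k %| n -> k < tau n.
Proof.
move=> n_gt0 k2n.
have injs : injective (expn 2) by move=> i j; apply: expnI.
rewrite -(size_iota 0 k.+1) -(size_map (expn 2)).
apply: uniq_leq_size; first by rewrite (map_inj_uniq injs) iota_uniq.
move=> d /mapP[i]; rewrite mem_iota add0n ltnS /= => le_ik ->.
by rewrite -dvdn_divisors // (dvdn_trans _ k2n) // dvdn_exp2l.
Qed.

(* Among 2 ^ k consecutive integers one is divisible by 2 ^ k, and hence has
   more than k divisors: the lengths of runs are bounded. *)
Lemma run_length_bound (k L : nat) : run_length k L -> L <= 2 ^ k.
Proof.
move=> /asboolP[n [n_gt0 run]]; rewrite leqNgt; apply/negP => ltL.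
have q_gt0 : 0 < 2 ^ k by rewrite expn_gt0.
pose i := 2 ^ k - n %% 2 ^ k.
have mod_lt : n %% 2 ^ k < 2 ^ k by rewrite ltn_mod.
have i_lt : i < L by rewrite (leq_ltn_trans _ ltL) // leq_subr.
have dv : 2 ^ k %| n + i.
  by rewrite /i {1}(divn_eq n (2 ^ k)) -addnA (subnKC (ltnW mod_lt)) -mulSnr
             dvdn_mull.
by have := tau_dvd_exp2 (ltn_addr i n_gt0) dv; rewrite (run _ i_lt) ltnn.
Qed.

Definition M (k : nat) : nat :=
  ex_maxn (run_length_ex k) (@run_length_bound k).

Lemma M_spec (k : nat) :
  (exists n, equidiv_run k (M k) n) /\
  (forall L n, equidiv_run k L n -> L <= M k).
Proof.
rewrite /M; case: ex_maxnP => m /asboolP run_m max_m; split=> // L n run.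
by apply: max_m; apply/asboolP; exists n.
Qed.

(* Main.v *)
Require Import Defs.
From mathcomp Require Import all_boot.
From Stdlib Require Import BinNat.

Set Implicit Arguments.
Unset Strict Implicit.
Unset Printing Implicit Defensive.

(** Upper bound: among 32 consecutive integers one is congruent to 16 modulo
    32, that is, of the form 16 m with m odd, and its number of divisors
    5 tau(m) differs from 48 because 5 does not divide 48
    ([equidiv_run_lt] with q = 5).

    Lower bound: the 17 integers from [run_start] on all have 48 divisors.
    Since tau is multiplicative, this is read off from their factorizations
    ([tau_factored]), once the factors are known to be prime.  Primality is
    proved with Pocklington's criterion ([pocklington]), applied along a chain
    of certificates in which each prime relies on smaller ones, down to 2
    ([pock_chain_prime]).  The terms have 39 digits, out of reach of unary
    arithmetic, so certificates and factorizations are checked in the binary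
    type N and the conclusions are transported to nat.

    The starting point was found by a computer search organised as follows.
    As 3 divides 48 and is prime, each term needs an exponent congruent to 2
    modulo 3 in its factorization.  The residue of the start modulo 64 gives
    four terms the exponent 2 or 5 at the prime 2 and makes every other 2-adic
    valuation at most 3; this also avoids valuation 4, which the upper bound
    forbids.  Two terms 9 apart get the factor 9, and the remaining eleven
    terms get one each of the squares of the primes from 5 to 41.  The Chinese
    remainder theorem turns these constraints into an arithmetic progression,
    which was sieved for a member whose 17 cofactors all have the number of
    divisors that is left. *)

(** * The number of divisors *)

(** The list of divisors is built by adjoining the prime powers one at a time:
    each of the e rounds for p ^ e merges in a copy of the initial list. *)
Lemma size_add_divisors p e s :
  size (PrimeDecompAux.add_divisors (p, e) s) = e.+1 * size s.
Proof.
rewrite /PrimeDecompAux.add_divisors.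
elim: e => [|e IHe] /=; first by rewrite mul1n.
by rewrite size_merge size_cat size_map IHe -mulSnr.
Qed.

Lemma tau_prod n : tau n = \prod_(p <- primes n) (logn p n).+1.
Proof.
rewrite /tau /divisors prime_decompE.
elim: (primes n) => [|p s IHs]; first by rewrite big_nil.
by rewrite big_cons -IHs /= size_add_divisors.
Qed.

(** The prime divisors of the two factors are disjoint, so the product in
    [tau_prod] splits in two. *)
Lemma tau_coprimeM m n :
  0 < m -> 0 < n -> coprime m n -> tau (m * n) = tau m * tau n.
Proof.
move=> m0 n0 co_mn.
have primes_mn : perm_eq (primes (m * n)) (primes m ++ primes n).
  apply: uniq_perm => [||p]; last by rewrite mem_cat primesM.
    exact: primes_uniq.
  by rewrite cat_uniq !primes_uniq -coprime_has_primes // co_mn.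
rewrite !tau_prod (perm_big _ primes_mn) big_cat /=.
congr (_ * _); apply: eq_big_seq => p;
  rewrite mem_primes => /and3P[p_pr _ p_dvd].
  by rewrite lognM // (@logn_coprime p n) ?addn0 // (coprime_dvdl p_dvd).
by rewrite lognM // (@logn_coprime p m) // coprime_sym (coprime_dvdr p_dvd).
Qed.

Lemma tau_pfactor p e : prime p -> tau (p ^ e) = e.+1.
Proof.
move=> p_pr; rewrite tau_prod; case: e => [|e]; first by rewrite big_nil.
by rewrite primesX // primes_prime // big_seq1 pfactorK.
Qed.

(** * Runs cannot be long *)

(** A run of length 2 ^ q would contain a term whose 2-adic valuation is
    exactly q - 1; the number of divisors of that term is a multiple of q. *)
Lemma equidiv_run_lt k q L n :
  0 < q -> ~~ (q %| k) -> equidiv_run k L n -> L < 2 ^ q.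
Proof.
case: q => // q _ q_k [n_gt0 run]; rewrite ltnNge; apply: contra q_k => leL.
set Q := 2 ^ q.+1; set h := 2 ^ q.
have h_gt0 : 0 < h by rewrite expn_gt0.
have hQ : h < Q by rewrite ltn_exp2l.
have nQ : n %% Q < Q by rewrite ltn_pmod // expn_gt0.
(* Adding i first clears n modulo Q, then adds h. *)
pose i := (h + (Q - n %% Q)) %% Q.
have i_lt : i < L by rewrite (leq_trans _ leL) // ltn_pmod // expn_gt0.
have ni : n + i = h %[mod Q].
  rewrite modnDmr addnCA -modnDmr -[(n + _) %% Q]modnDml.
  by rewrite subnKC ?modnn ?addn0 // ltnW.
have ni_h : (n + i) = h * (2 * ((n + i) %/ Q)).+1.
  rewrite {1}(divn_eq (n + i) Q) ni modn_small //.
  by rewrite mulnS addnC mulnA -expnSr mulnC.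
rewrite -(run i i_lt) ni_h tau_coprimeM // ?tau_pfactor ?dvdn_mulr //.
by rewrite coprimeXl // coprime2n /= mul2n odd_double.
Qed.

(** * Factored numbers *)

Definition factored (f : seq (nat * nat)) : bool :=
  all prime (unzip1 f) && uniq (unzip1 f).

Definition factored_value (f : seq (nat * nat)) : nat :=
  \prod_(x <- f) x.1 ^ x.2.

Lemma factored_cons p e f : factored ((p, e) :: f) ->
  [/\ prime p, factored f & coprime (p ^ e) (factored_value f)].
Proof.
rewrite /factored /= => /andP[/andP[p_pr f_pr] /andP[pf f_uniq]].
split; rewrite ?f_pr // coprimeXl // /factored_value.
elim: f pf f_pr {f_uniq} => [|[q d] f IHf]; first by rewrite big_nil coprimen1.
rewrite !inE negb_or /= => /andP[pq pf] /andP[q_pr f_pr].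
rewrite big_cons coprimeMr IHf // coprimeXr // prime_coprime //.
by rewrite dvdn_prime2 // pq.
Qed.

Lemma factored_value_gt0 f : factored f -> 0 < factored_value f.
Proof.
move=> /andP[f_pr _]; rewrite /factored_value big_seq.
apply: prodn_cond_gt0 => x xf.
by rewrite expn_gt0 prime_gt0 // (allP f_pr) // map_f.
Qed.

Lemma tau_factored f :
  factored f -> tau (factored_value f) = \prod_(x <- f) x.2.+1.
Proof.
elim: f => [|[p e] f IHf]; first by rewrite /factored_value !big_nil.
move=> fpf; have [p_pr ff co] := factored_cons fpf.
rewrite big_cons /factored_value big_cons tau_coprimeM ?tau_pfactor ?IHf //.
  by rewrite expn_gt0 prime_gt0.
exact: factored_value_gt0.
Qed.

Lemma dvdn_factored f m : factored f ->
  (factored_value f %| m) = all (fun x => x.1 ^ x.2 %| m) f.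
Proof.
elim: f => [|[p e] f IHf]; first by rewrite /factored_value big_nil dvd1n.
move=> fpf; have [p_pr ff co] := factored_cons fpf.
by rewrite /factored_value big_cons Gauss_dvd //= -IHf.
Qed.

(** * Pocklington's primality criterion *)

(** Bezout: the gcd is a combination u m - v n, so a ^ (u m) = 1 equals
    a ^ (v n) times a ^ gcd, whose first factor is 1 as well. *)
Lemma expn_gcd_mod1 a m n r : 0 < m ->
  a ^ m = 1 %[mod r] -> a ^ n = 1 %[mod r] -> a ^ gcdn m n = 1 %[mod r].
Proof.
move=> m_gt0 am an; case: (egcdnP n m_gt0) => u v uv _.
have pow1 k d : a ^ k = 1 %[mod r] -> a ^ (d * k) = 1 %[mod r].
  by move=> ak; rewrite mulnC expnM -modnXm ak modnXm exp1n.
by rewrite -(pow1 _ u am) uv expnD -modnMml pow1 // modnMml mul1n.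
Qed.

(** Let g = gcd (N - 1) (r - 1): then a ^ g is 1 modulo r, by Fermat's little
    theorem.  If g divided (N - 1) / q, then a ^ ((N - 1) / q) would be 1
    modulo r and r would divide both x - 1 and N.  So q does not divide
    (N - 1) / g, and the power q ^ e divides g, which divides r - 1.  The
    number x stands for a residue of a ^ ((N - 1) / q), since the power itself
    is too large to be computed. *)
Lemma pocklington_factor N a x q e r :
  prime r -> r %| N -> prime q -> q ^ e %| N.-1 -> 1 < N ->
  a ^ N.-1 = 1 %[mod N] -> x = a ^ (N.-1 %/ q) %[mod N] -> coprime x.-1 N ->
  q ^ e %| r.-1.
Proof.
move=> r_pr rN q_pr qeN N_gt1 aN x_a co_x.
have M_gt0 : 0 < N.-1 by case: N N_gt1 {rN qeN aN x_a co_x} => [|[]].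
have mod_r u v : u = v %[mod N] -> u = v %[mod r].
  by move=> uv; rewrite -(modn_dvdm _ rN) uv modn_dvdm.
have r_a : coprime a r.
  rewrite coprime_sym prime_coprime //; apply/negP => ra.
  have /eqP := mod_r _ _ aN.
  by rewrite -modnXm (eqP ra) exp0n // mod0n modn_small ?prime_gt1.
have ar : a ^ r.-1 = 1 %[mod r].
  have a_gt0 : 0 < a.
    case: a r_a {aN x_a} => //; rewrite /coprime gcd0n.
    by case: r r_pr {rN mod_r} => [|[]].
  have /eqP : a * a ^ r.-1 = a * 1 %[mod r].
    by rewrite muln1 -expnS prednK ?prime_gt0 // fermat_little.
  rewrite eqn_mod_dvd ?leq_pmul2l ?expn_gt0 ?a_gt0 // -mulnBr.
  rewrite Gauss_dvdr 1?coprime_sym // -eqn_mod_dvd ?expn_gt0 ?a_gt0 //.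
  by move/eqP.
have ag := expn_gcd_mod1 M_gt0 (mod_r _ _ aN) ar.
have not_x : a ^ (N.-1 %/ q) <> 1 %[mod r].
  rewrite -(mod_r _ _ x_a) => xr.
  have : r %| gcdn x.-1 N.
    rewrite dvdn_gcd rN andbT; case: x xr {x_a co_x} => // x /eqP.
    by rewrite eqn_mod_dvd // subn1.
  by rewrite (eqP co_x) dvdn1 => /eqP r1; rewrite r1 in r_pr.
set g := gcdn N.-1 r.-1 in ag.
have gM : g %| N.-1 by rewrite dvdn_gcdl.
apply: (dvdn_trans _ (dvdn_gcdr N.-1 r.-1)); rewrite -/g.
move: qeN; rewrite -{1}(divnK gM) Gauss_dvdr // coprimeXl // prime_coprime //.
apply/negP => /dvdnP[k Mk]; apply: not_x.
have -> : N.-1 %/ q = g * k.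
  by rewrite -(divnK gM) Mk mulnAC mulnK ?prime_gt0 // mulnC.
by rewrite expnM -modnXm ag modnXm exp1n.
Qed.

(** By [pocklington_factor] every prime divisor of N is congruent to 1 modulo
    the factored part F of N - 1, hence larger than F; as N <= F ^ 2, the
    least prime divisor of N exceeds the square root of N. *)
Lemma pocklington N a f :
    1 < N -> factored f -> factored_value f %| N.-1 ->
    N <= factored_value f ^ 2 -> a ^ N.-1 = 1 %[mod N] ->
    (forall q, q \in unzip1 f ->
       exists2 x, x = a ^ (N.-1 %/ q) %[mod N] & coprime x.-1 N) ->
  prime N.
Proof.
move=> N_gt1 ff fN N_le aN gen; apply: ltn_pdiv2_prime; first exact: ltnW.
set r := pdiv N; have r_pr : prime r := pdiv_prime N_gt1.
have fr : factored_value f %| r.-1.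
  have := fN; rewrite !dvdn_factored // => /allP qN; apply/allP => -[q e] qf.
  have q_in : q \in unzip1 f by apply: map_f qf.
  have [x x_a co_x] := gen q q_in.
  apply: (pocklington_factor r_pr (pdiv_dvd N) _ (qN _ qf) N_gt1 aN x_a co_x).
  by case/andP: ff => /allP/(_ q q_in).
apply: leq_ltn_trans N_le _; rewrite ltn_sqr.
have r1 : 0 < r.-1 by rewrite -ltnS prednK ?prime_gt0 ?prime_gt1.
by rewrite (leq_ltn_trans (dvdn_leq r1 fr)) // prednK ?prime_gt0.
Qed.

(** * Binary arithmetic *)

Lemma nat_of_addN (m n : N) : (m + n)%num = m + n :> nat.
Proof. by case: m n => [|p] [|q] //=; rewrite ?addn0 ?nat_of_add_pos. Qed.

Lemma nat_of_mulN (m n : N) : (m * n)%num = m * n :> nat.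
Proof. by case: m n => [|p] [|q] //=; rewrite ?muln0 ?nat_of_mul_pos. Qed.

Lemma nat_of_bin_modN (m n : N) : (m mod n)%num = m %[mod n].
Proof.
by rewrite {2}(N.div_mod' m n) nat_of_addN nat_of_mulN mulnC modnMDl.
Qed.

Lemma nat_of_succN (n : N) : N.succ n = n.+1 :> nat.
Proof. by case: n => //= p; rewrite nat_of_succ_pos. Qed.

Lemma nat_of_predN (n : N) : N.pred n = n.-1 :> nat.
Proof.
case: n => // p; rewrite -{2}(N.succ_pred (N.pos p)) //.
by case: (N.pred _) => //= q; rewrite nat_of_succ_pos.
Qed.

Lemma nat_of_leN (m n : N) : (m <=? n)%num -> (m <= n).
Proof.
by move=> /N.leb_le /N.sub_add <-; rewrite nat_of_addN leq_addl.
Qed.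

Lemma nat_of_ltN (m n : N) : (m <? n)%num -> m < n.
Proof.
by move=> /N.ltb_lt /N.le_succ_l /N.leb_le /nat_of_leN; rewrite nat_of_succN.
Qed.

Lemma nat_of_divN (m n : N) : (m / n)%num = m %/ n :> nat.
Proof.
have [->|/eqP n_neq0] := eqVneq n 0%num; first by case: m.
have /N.ltb_lt/nat_of_ltN mn := N.mod_lt m n n_neq0.
rewrite {2}(N.div_mod' m n) nat_of_addN nat_of_mulN mulnC.
by rewrite divnMDl ?(leq_ltn_trans _ mn) // divn_small // addn0.
Qed.

Lemma nat_of_expN (p e : N) : (p ^ e)%num = p ^ e :> nat.
Proof.
elim/N.peano_ind: e => [|e IHe]; first by rewrite N.pow_0_r.
rewrite N.pow_succ_r' nat_of_mulN IHe -expnS; congr expn.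
by case: e {IHe} => //= q; rewrite nat_of_succ_pos.
Qed.

(** Divisibility in N and in nat have the same witnesses, so the gcd in nat
    divides the gcd in N. *)
Lemma nat_of_coprimeN (m n : N) : N.gcd m n = 1%num -> coprime m n.
Proof.
move=> co; rewrite /coprime -dvdn1 -[1]/(nat_of_bin 1%num) -co.
have divN (d : nat) (k : N) : d %| k -> N.divide (bin_of_nat d) k.
  move=> /dvdnP[c kc]; exists (bin_of_nat c).
  by apply: (can_inj nat_of_binK); rewrite nat_of_mulN !bin_of_natK.
have [c ->] : N.divide (bin_of_nat (gcdn m n)) (N.gcd m n).
  by apply: N.gcd_greatest; apply: divN; rewrite ?dvdn_gcdl ?dvdn_gcdr.
by rewrite nat_of_mulN bin_of_natK dvdn_mull.
Qed.

(** The exponent is read from its most significant bit, so that the extra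
    factor at each 1 bit is the base itself, which is small in all the
    certificates below. *)
Fixpoint powmod (n a : N) (e : positive) : N :=
  match e with
  | xH => a mod n
  | xO e' => let b := powmod n a e' in (b * b) mod n
  | xI e' => let b := powmod n a e' in (a * ((b * b) mod n)) mod n
  end%num.

Lemma powmodE n a (e : positive) : powmod n a e = a ^ nat_of_pos e %[mod n].
Proof.
have sqE e' : powmod n a e' = a ^ nat_of_pos e' %[mod n] ->
    ((powmod n a e' * powmod n a e') mod n)%num
      = a ^ (nat_of_pos e').*2 %[mod n].
  move=> IHe; rewrite nat_of_bin_modN nat_of_mulN -modnMm IHe modnMm.
  by rewrite -expnD addnn.
elim: e => [e /sqE IHe|e /sqE IHe|] /=; rewrite ?NatTrec.trecE //.
  by rewrite nat_of_bin_modN nat_of_mulN -modnMmr IHe modnMmr expnS.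
by rewrite nat_of_bin_modN expn1.
Qed.

Definition powmodN (n a e : N) : N :=
  if e is N.pos e' then powmod n a e' else (1 mod n)%num.

Lemma powmodNE n a e : powmodN n a e = a ^ e %[mod n].
Proof. by case: e => [|e]; [rewrite nat_of_bin_modN | apply: powmodE]. Qed.

(** * Checking certificates *)

Definition bin_fact := seq (N * N).

Definition bin_fact_value (f : bin_fact) : N :=
  foldr (fun x v => x.1 ^ x.2 * v)%num 1%num f.

Definition bin_fact_tau (f : bin_fact) : N :=
  foldr (fun x v => N.succ x.2 * v)%num 1%num f.

Definition nat_of_bin_fact (f : bin_fact) : seq (nat * nat) :=
  [seq (nat_of_bin x.1, nat_of_bin x.2) | x <- f].

Lemma nat_of_bin_fact_value f :
  bin_fact_value f = factored_value (nat_of_bin_fact f) :> nat.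
Proof.
rewrite /factored_value; elim: f => [|x f IHf] /=; first by rewrite big_nil.
by rewrite big_cons nat_of_mulN nat_of_expN IHf.
Qed.

Lemma nat_of_bin_fact_tau f :
  bin_fact_tau f = \prod_(x <- nat_of_bin_fact f) x.2.+1 :> nat.
Proof.
elim: f => [|x f IHf] /=; first by rewrite big_nil.
rewrite big_cons nat_of_mulN IHf; congr (_ * _).
by case: x.2 => //= q; rewrite nat_of_succ_pos.
Qed.

Definition known_fact (known : seq N) (f : bin_fact) : bool :=
  all [in known] (unzip1 f) && uniq (unzip1 f).

Lemma factored_known known f : {in known, forall p : N, prime p} ->
  known_fact known f -> factored (nat_of_bin_fact f).
Proof.
move=> known_pr /andP[/allP f_known f_uniq]; apply/andP.
have -> : unzip1 (nat_of_bin_fact f) = map nat_of_bin (unzip1 f).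
  by rewrite /unzip1 /nat_of_bin_fact -!map_comp.
split; last by rewrite (map_inj_uniq (can_inj nat_of_binK)).
by apply/allP => _ /mapP[q /f_known/known_pr q_pr ->].
Qed.

(** A certificate for [pock_prime]: the base of the powers and the factored
    part of [pock_prime] - 1. *)
Record pock_step := PockStep { pock_prime : N; pock_base : N; pock_fact : bin_fact }.

Definition pock_check (known : seq N) (s : pock_step) : bool :=
  let: PockStep n a f := s in
  let F := bin_fact_value f in
  [&& (1 <? n)%num, known_fact known f, ((N.pred n) mod F == 0)%num,
      (n <=? F * F)%num, powmodN n a (N.pred n) == 1%num
    & all (fun q => N.gcd (N.pred (powmodN n a (N.pred n / q))) n == 1)%num
          (unzip1 f)].

Lemma pock_check_prime known s : {in known, forall p : N, prime p} ->
  pock_check known s -> prime (pock_prime s).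
Proof.
case: s => n a f known_pr /=.
case/and5P=> [n_gt1 /(factored_known known_pr) ff /eqP F_dvd F_le].
case/andP=> /eqP a1 /allP gen.
apply: (@pocklington n a (nat_of_bin_fact f)) => //.
- exact: nat_of_ltN n_gt1.
- rewrite -nat_of_bin_fact_value -nat_of_predN /dvdn.
  by rewrite -nat_of_bin_modN F_dvd mod0n.
- by rewrite -nat_of_bin_fact_value -mulnn -nat_of_mulN nat_of_leN.
- by rewrite -nat_of_predN -powmodNE a1.
move=> _ /mapP[_ /mapP[x xf ->] ->] /=.
exists (powmodN n a (N.pred n / x.1)%num).
  by rewrite powmodNE nat_of_divN nat_of_predN.
by rewrite -nat_of_predN nat_of_coprimeN // (eqP (gen x.1 _)) ?map_f.
Qed.

Fixpoint pock_chain (known : seq N) (ss : seq pock_step) : bool :=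
  if ss is s :: ss' then
    pock_check known s && pock_chain (pock_prime s :: known) ss'
  else true.

Lemma pock_chain_prime known ss : {in known, forall p : N, prime p} ->
  pock_chain known ss ->
  {in catrev (map pock_prime ss) known, forall p : N, prime p}.
Proof.
elim: ss known => //= s ss IHss known known_pr /andP[s_ok ss_ok].
apply: IHss ss_ok => p; rewrite inE => /predU1P[->|/known_pr //].
exact: pock_check_prime s_ok.
Qed.

Fixpoint run_check (known : seq N) (k n : N) (fs : seq bin_fact) : bool :=
  if fs is f :: fs' then
    [&& known_fact known f, bin_fact_value f == n, bin_fact_tau f == k
      & run_check known k (N.succ n) fs']
  else true.

Lemma run_check_tau known k n fs i : {in known, forall p : N, prime p} ->
  run_check known k n fs -> i < size fs -> tau (n + i) = k.
Proof.
move=> known_pr; elim: fs n i => //= f fs IHfs n i.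
case/and4P=> f_known /eqP fn /eqP fk fs_ok.
case: i => [_|i]; last by move/(IHfs _ _ fs_ok); rewrite nat_of_succN addSnnS.
rewrite addn0 -fn -fk nat_of_bin_fact_value nat_of_bin_fact_tau tau_factored //.
exact: factored_known f_known.
Qed.

(** * A run of 17 integers with 48 divisors *)

(** Increasing order makes each certificate refer only to primes that precede
    it; the chain starts from the prime 2. *)
Definition pocklington_table : seq pock_step :=
  [::
    PockStep 3 2 [:: (2, 1)];
    PockStep 5 2 [:: (2, 2)];
    PockStep 7 2 [:: (3, 1)];
    PockStep 11 2 [:: (5, 1)];
    PockStep 13 2 [:: (2, 2)];
    PockStep 17 3 [:: (2, 4)];
    PockStep 19 2 [:: (3, 2)];
    PockStep 23 2 [:: (11, 1)];
    PockStep 29 2 [:: (7, 1)];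
    PockStep 31 3 [:: (2, 1); (3, 1)];
    PockStep 37 2 [:: (3, 2)];
    PockStep 41 3 [:: (2, 3)];
    PockStep 43 2 [:: (7, 1)];
    PockStep 47 2 [:: (23, 1)];
    PockStep 59 2 [:: (29, 1)];
    PockStep 61 2 [:: (2, 2); (3, 1)];
    PockStep 67 2 [:: (11, 1)];
    PockStep 71 7 [:: (2, 1); (5, 1)];
    PockStep 79 2 [:: (13, 1)];
    PockStep 83 2 [:: (41, 1)];
    PockStep 89 2 [:: (11, 1)];
    PockStep 97 5 [:: (2, 5)];
    PockStep 103 2 [:: (17, 1)];
    PockStep 109 3 [:: (3, 3)];
    PockStep 113 3 [:: (2, 4)];
    PockStep 127 3 [:: (2, 1); (3, 2)];
    PockStep 139 2 [:: (23, 1)];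
    PockStep 151 3 [:: (5, 2)];
    PockStep 157 2 [:: (13, 1)];
    PockStep 163 2 [:: (3, 4)];
    PockStep 173 2 [:: (43, 1)];
    PockStep 179 2 [:: (89, 1)];
    PockStep 191 2 [:: (19, 1)];
    PockStep 199 3 [:: (2, 1); (3, 2)];
    PockStep 223 2 [:: (37, 1)];
    PockStep 229 2 [:: (19, 1)];
    PockStep 241 7 [:: (2, 4)];
    PockStep 251 3 [:: (5, 3)];
    PockStep 257 3 [:: (2, 8)];
    PockStep 269 2 [:: (67, 1)];
    PockStep 281 3 [:: (2, 3); (5, 1)];
    PockStep 311 2 [:: (31, 1)];
    PockStep 379 2 [:: (3, 3)];
    PockStep 397 5 [:: (2, 2); (3, 2)];
    PockStep 443 2 [:: (2, 1); (13, 1)];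
    PockStep 449 3 [:: (2, 6)];
    PockStep 509 2 [:: (127, 1)];
    PockStep 523 2 [:: (29, 1)];
    PockStep 541 2 [:: (3, 3)];
    PockStep 569 2 [:: (71, 1)];
    PockStep 577 5 [:: (2, 6)];
    PockStep 661 2 [:: (2, 2); (11, 1)];
    PockStep 709 2 [:: (59, 1)];
    PockStep 733 2 [:: (61, 1)];
    PockStep 739 2 [:: (41, 1)];
    PockStep 757 2 [:: (2, 2); (3, 3)];
    PockStep 761 6 [:: (2, 3); (5, 1)];
    PockStep 827 2 [:: (59, 1)];
    PockStep 887 2 [:: (443, 1)];
    PockStep 937 5 [:: (2, 3); (3, 2)];
    PockStep 953 3 [:: (2, 3); (7, 1)];
    PockStep 1019 2 [:: (509, 1)];
    PockStep 1033 2 [:: (43, 1)];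
    PockStep 1063 2 [:: (59, 1)];
    PockStep 1423 2 [:: (79, 1)];
    PockStep 1447 2 [:: (241, 1)];
    PockStep 1523 2 [:: (761, 1)];
    PockStep 1559 2 [:: (41, 1)];
    PockStep 1669 2 [:: (139, 1)];
    PockStep 1889 2 [:: (59, 1)];
    PockStep 2039 2 [:: (1019, 1)];
    PockStep 2549 2 [:: (2, 2); (7, 2)];
    PockStep 2677 2 [:: (223, 1)];
    PockStep 2957 2 [:: (739, 1)];
    PockStep 3373 2 [:: (281, 1)];
    PockStep 3779 2 [:: (1889, 1)];
    PockStep 4001 2 [:: (5, 3)];
    PockStep 4253 2 [:: (1063, 1)];
    PockStep 4657 2 [:: (97, 1)];
    PockStep 4721 6 [:: (2, 4); (5, 1)];
    PockStep 6113 2 [:: (191, 1)];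
    PockStep 6301 2 [:: (2, 2); (5, 2)];
    PockStep 6329 2 [:: (113, 1)];
    PockStep 6353 2 [:: (397, 1)];
    PockStep 8087 2 [:: (311, 1)];
    PockStep 10331 2 [:: (1033, 1)];
    PockStep 10957 2 [:: (2, 2); (83, 1)];
    PockStep 12037 2 [:: (2, 2); (59, 1)];
    PockStep 12553 2 [:: (523, 1)];
    PockStep 14543 2 [:: (661, 1)];
    PockStep 14561 6 [:: (2, 5); (5, 1)];
    PockStep 14621 2 [:: (2, 2); (43, 1)];
    PockStep 15161 2 [:: (379, 1)];
    PockStep 20681 3 [:: (2, 3); (47, 1)];
    PockStep 23899 2 [:: (569, 1)];
    PockStep 24007 2 [:: (4001, 1)];
    PockStep 26237 2 [:: (937, 1)];
    PockStep 27943 2 [:: (4657, 1)];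
    PockStep 29123 2 [:: (14561, 1)];
    PockStep 36653 2 [:: (2, 2); (7, 2)];
    PockStep 41117 2 [:: (541, 1)];
    PockStep 50593 5 [:: (2, 5); (17, 1)];
    PockStep 57041 6 [:: (2, 4); (23, 1)];
    PockStep 73477 2 [:: (2, 2); (157, 1)];
    PockStep 87421 3 [:: (31, 1); (47, 1)];
    PockStep 111773 2 [:: (27943, 1)];
    PockStep 120371 2 [:: (12037, 1)];
    PockStep 120929 2 [:: (3779, 1)];
    PockStep 160621 2 [:: (2677, 1)];
    PockStep 190181 2 [:: (2, 2); (257, 1)];
    PockStep 218819 2 [:: (2957, 1)];
    PockStep 236111 2 [:: (3373, 1)];
    PockStep 285767 5 [:: (2, 1); (379, 1)];
    PockStep 380147 2 [:: (14621, 1)];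
    PockStep 408361 11 [:: (2, 3); (83, 1)];
    PockStep 684493 2 [:: (57041, 1)];
    PockStep 705779 2 [:: (23, 1); (67, 1)];
    PockStep 715811 2 [:: (1523, 1)];
    PockStep 848429 2 [:: (7, 1); (157, 1)];
    PockStep 896573 2 [:: (2, 2); (251, 1)];
    PockStep 1696859 2 [:: (848429, 1)];
    PockStep 1741609 17 [:: (2, 3); (733, 1)];
    PockStep 1793147 2 [:: (896573, 1)];
    PockStep 1859563 2 [:: (59, 1); (103, 1)];
    PockStep 3200401 11 [:: (2, 4); (127, 1)];
    PockStep 3881671 2 [:: (13, 1); (269, 1)];
    PockStep 6150971 2 [:: (12553, 1)];
    PockStep 6966437 2 [:: (1741609, 1)];
    PockStep 7110683 2 [:: (36653, 1)];
    PockStep 7416931 2 [:: (14543, 1)];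
    PockStep 7813801 11 [:: (2, 3); (1447, 1)];
    PockStep 21722213 2 [:: (236111, 1)];
    PockStep 24172781 2 [:: (2, 2); (41, 2)];
    PockStep 28581337 2 [:: (6301, 1)];
    PockStep 30064063 2 [:: (715811, 1)];
    PockStep 32018687 2 [:: (120371, 1)];
    PockStep 35157701 2 [:: (20681, 1)];
    PockStep 35538641 2 [:: (10331, 1)];
    PockStep 40475803 2 [:: (24007, 1)];
    PockStep 128489687 2 [:: (380147, 1)];
    PockStep 159925247 2 [:: (6150971, 1)];
    PockStep 193382249 2 [:: (24172781, 1)];
    PockStep 435397243 2 [:: (223, 1); (229, 1)];
    PockStep 937656121 2 [:: (7813801, 1)];
    PockStep 1137093457 5 [:: (2, 4); (6329, 1)];
    PockStep 1411258913 2 [:: (179, 1); (577, 1)];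
    PockStep 1457128909 2 [:: (40475803, 1)];
    PockStep 2238953459 2 [:: (159925247, 1)];
    PockStep 4548373829 2 [:: (1137093457, 1)];
    PockStep 5963693027 2 [:: (218819, 1)];
    PockStep 13206616427 2 [:: (1859563, 1)];
    PockStep 30171369883 2 [:: (2, 1); (160621, 1)];
    PockStep 32056835999 2 [:: (1457128909, 1)];
    PockStep 40301162263 2 [:: (2238953459, 1)];
    PockStep 49327633709 2 [:: (35538641, 1)];
    PockStep 49635285703 2 [:: (435397243, 1)];
    PockStep 101506724537 3 [:: (2, 3); (285767, 1)];
    PockStep 320703947803 2 [:: (757, 1); (2039, 1)];
    PockStep 432003002471 2 [:: (13, 1); (50593, 1)];
    PockStep 517893826441 2 [:: (28581337, 1)];
    PockStep 1009117964137 2 [:: (7416931, 1)];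
    PockStep 6184442292943 2 [:: (31, 2); (6353, 1)];
    PockStep 10392510635333 2 [:: (1411258913, 1)];
    PockStep 90073999241981 2 [:: (41, 1); (199, 1); (1423, 1)];
    PockStep 109411211989073 3 [:: (2, 4); (684493, 1)];
    PockStep 180147998483963 2 [:: (90073999241981, 1)];
    PockStep 575061615352327 2 [:: (449, 1); (87421, 1)];
    PockStep 11948342509965877 2 [:: (6184442292943, 1)];
    PockStep 51544427919745483 5 [:: (3, 2); (32018687, 1)];
    PockStep 661503450433112137 2 [:: (180147998483963, 1)];
    PockStep 1378878311095982441 2 [:: (10392510635333, 1)];
    PockStep 1467038562336347887 2 [:: (4548373829, 1)];
    PockStep 23912114144947184699 2 [:: (23899, 1); (3200401, 1)];
    PockStep 76985601775044968437 2 [:: (37, 2); (6966437, 1)];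
    PockStep 3146600305921031930363 2 [:: (1378878311095982441, 1)];
    PockStep 4495477459250070723413 2 [:: (23912114144947184699, 1)];
    PockStep 4878255011830920910909 2 [:: (29123, 1); (30064063, 1)];
    PockStep 7743940679638325406631 2 [:: (109411211989073, 1)];
    PockStep 9686435072390250147293 2 [:: (51544427919745483, 1)];
    PockStep 54600862777626130361531 2 [:: (953, 1); (41117, 1); (73477, 1)];
    PockStep 109201725555252260723063 2 [:: (54600862777626130361531, 1)];
    PockStep 195130200473236836436361 2 [:: (4878255011830920910909, 1)];
    PockStep 199392179115004795529693 2 [:: (1009117964137, 1)];
    PockStep 2864734761291810986816537 2 [:: (120929, 1); (35157701, 1)];
    PockStep 1593241051344133525047617947 2 [:: (11948342509965877, 1)];
    PockStep 4797105046866488964496118977 2 [:: (21722213, 1); (193382249, 1)];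
    PockStep 3462300773728363734916516298287 2 [:: (76985601775044968437, 1)];
    PockStep 16987551113219935474713233734621 2 [:: (26237, 1); (517893826441, 1)];
    PockStep 42633624478179068037934218775849 2 [:: (79, 1); (575061615352327, 1)];
    PockStep 91005947392756777665636280890571 2 [:: (3881671, 1); (13206616427, 1)]]%num.

Definition run_facts : seq bin_fact :=
  [::
    [:: (2, 2); (5, 1); (709, 1); (49635285703, 1); (195130200473236836436361, 1)];
    [:: (11, 1); (29, 2); (1696859, 1); (5963693027, 1); (1467038562336347887, 1)];
    [:: (2, 1); (3, 1); (7, 2); (10957, 1); (42633624478179068037934218775849, 1)];
    [:: (41, 2); (509, 1); (32056835999, 1); (49327633709, 1); (101506724537, 1)];
    [:: (2, 5); (4253, 1); (320703947803, 1); (3146600305921031930363, 1)];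
    [:: (3, 2); (5, 1); (109, 1); (8087, 1); (3462300773728363734916516298287, 1)];
    [:: (2, 1); (13, 2); (408361, 1); (128489687, 1); (7743940679638325406631, 1)];
    [:: (17, 2); (59, 1); (827, 1); (6113, 1); (1593241051344133525047617947, 1)];
    [:: (2, 2); (3, 1); (111773, 1); (937656121, 1); (109201725555252260723063, 1)];
    [:: (7, 1); (19, 2); (190181, 1); (432003002471, 1); (661503450433112137, 1)];
    [:: (2, 1); (5, 2); (15161, 1); (40301162263, 1); (4495477459250070723413, 1)];
    [:: (3, 1); (31, 2); (163, 1); (30171369883, 1); (9686435072390250147293, 1)];
    [:: (2, 3); (11, 2); (1559, 1); (91005947392756777665636280890571, 1)];
    [:: (37, 2); (151, 1); (4721, 1); (705779, 1); (199392179115004795529693, 1)];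
    [:: (2, 1); (3, 2); (887, 1); (1793147, 1); (4797105046866488964496118977, 1)];
    [:: (5, 1); (23, 2); (2549, 1); (7110683, 1); (2864734761291810986816537, 1)];
    [:: (2, 2); (7, 1); (173, 1); (1669, 1); (16987551113219935474713233734621, 1)]]%num.

Definition run_start : N := 137338167281777966256543699127331382940.

Definition table_primes : seq N :=
  catrev (map pock_prime pocklington_table) [:: 2%num].

Lemma pocklington_table_ok : pock_chain [:: 2%num] pocklington_table.
Proof. by vm_compute. Qed.

Lemma run_facts_ok : run_check table_primes 48 run_start run_facts.
Proof. by vm_compute. Qed.

Lemma run_start_equidiv : equidiv_run 48 17 run_start.
Proof.
have table_primes_pr : {in table_primes, forall p : N, prime p}.
  by apply: pock_chain_prime pocklington_table_ok => _ /[!inE] /eqP->.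
split=> [|i i_lt]; first exact: (@nat_of_ltN 0).
exact: (run_check_tau table_primes_pr run_facts_ok).
Qed.

Theorem lemma8 : 17 <= M 48 <= 31.
Proof.
have [[n run] maxM] := M_spec 48.
by rewrite (maxM _ _ run_start_equidiv) -ltnS (@equidiv_run_lt 48 5 _ n).
Qed.
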